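(* Let $\pi^*$ be an absolutely continuous probability distribution on $\mathbb{R}^{D_x}\times\mathbb{R}^{D_y}$ with marginals $\pi^*_x,\pi^*_y$, and let $\varepsilon>0$. Let $\mathcal{C}$ be a class of measurable cost functions $c:\mathbb{R}^{D_x}\times\mathbb{R}^{D_y}\to\mathbb{R}$ and $\mathcal{F}$ a class of continuous functions $f:\mathbb{R}^{D_y}\to\mathbb{R}$ such that for every $c\in\mathcal{C}$ the semi-dual representation $$\mathrm{EOT}_{c,\varepsilon}(\pi^*_x,\pi^*_y)=\max_{f\in\mathcal{F}}\Big\{\mathbb{E}_{x\sim\pi^*_x}f^{c}(x)+\mathbb{E}_{y\sim\pi^*_y}f(y)\Big\}$$ holds, all expectations involved being finite. Then the inverse entropic optimal transport problem $$\inf_{c\in\mathcal{C}}\Big[\mathbb{E}_{(x,y)\sim\pi^*}[c(x,y)]-\varepsilon\,\mathbb{E}_{x\sim\pi^*_x}\mathrm{H}(\pi^*(\cdot|x))-\mathrm{EOT}_{c,\varepsilon}(\pi^*_x,\pi^*_y)\Big]$$ is equal, up to the additive constant $-\varepsilon\,\mathbb{E}_{x\sim\pi^*_x}\mathrm{H}(\pi^*(\cdot|x))$ (which does not depend on $c$), to $$\inf_{c\in\mathcal{C},\,f\in\mathcal{F}}\Big\{\mathbb{E}_{(x,y)\sim\pi^*}[c(x,y)]-\mathbb{E}_{x\sim\pi^*_x}f^{c}(x)-\mathbb{E}_{y\sim\pi^*_y}f(y)\Big\},$$ and for $c=c^\theta\in\mathcal{C}$, $f=f^\theta\in\mathcal{F}$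 one has $(f^\theta)^{c^\theta}(x)=-\varepsilon\log Z^\theta(x)$, so that the expression in braces equals $\varepsilon\,\mathcal{L}(\theta)$, where $$\mathcal{L}(\theta)=\varepsilon^{-1}\mathbb{E}_{(x,y)\sim\pi^*}[c^\theta(x,y)]-\varepsilon^{-1}\mathbb{E}_{y\sim\pi^*_y}f^\theta(y)+\mathbb{E}_{x\sim\pi^*_x}\log Z^\theta(x).$$
   Context: $\mathrm{H}(\beta)=-\int\beta(y)\log\beta(y)\,dy$ is differential entropy. The entropic optimal transport cost is $\mathrm{EOT}_{c,\varepsilon}(\alpha,\beta)=\min_{\pi\in\Pi(\alpha,\beta)}\mathbb{E}_{(x,y)\sim\pi}[c(x,y)]-\varepsilon\,\mathbb{E}_{x\sim\alpha}\mathrm{H}(\pi(\cdot|x))$, where $\Pi(\alpha,\beta)$ is the set of joint distributions with marginals $\alpha,\beta$. The weak entropic $c$-transform of $f$ is $f^{c}(x)=-\varepsilon\log\int_{\mathbb{R}^{D_y}}\exp\big((f(y)-c(x,y))/\varepsilon\big)\,dy$. For parametric functions $c^\theta,f^\theta$ (with parameter $\theta$) the energy is $E^\theta(y|x)=(c^\theta(x,y)-f^\theta(y))/\varepsilon$ and the normalization constant is $Z^\theta(x)=\int_{\mathbb{R}^{D_y}}\exp(-E^\theta(y|x))\,dy$. *)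

(* Defs.v *)
From HB Require Import structures.
From mathcomp Require Import all_boot all_order all_algebra.
From mathcomp Require Import all_classical all_reals all_analysis.

Set Implicit Arguments.
Unset Strict Implicit.
Unset Printing Implicit Defensive.
Import Order.TTheory GRing.Theory Num.Theory.
Import numFieldNormedType.Exports.

Local Open Scope classical_set_scope.
Local Open Scope ring_scope.
Local Open Scope charge_scope.
Local Open Scope ereal_scope.

(* R^n is ['rV[R]_n], with its usual topology and the sigma-algebra generated by
   the coordinates, i.e. the product of the Borel sigma-algebras of R.  This is
   the analogue of the library's instance for [n.-tuple R]; row vectors are used
   because they carry the topology as well. *)

Definition measure_rV_display : measure_display.
Proof. exact: default_measure_display. Qed.

Section measurable_rV.
Context (R : realType) (n : nat).

Definition coord_rV (i : 'I_n) (v : 'rV[R]_n) : R := v ord0 i.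

Let rV_set0 : g_sigma_preimage coord_rV set0.
Proof. exact: sigma_algebra0. Qed.

Let rV_setC A : g_sigma_preimage coord_rV A -> g_sigma_preimage coord_rV (~` A).
Proof. exact: sigma_algebraC. Qed.

Let rV_bigcup (F : (set 'rV[R]_n)^nat) :
  (forall i, g_sigma_preimage coord_rV (F i)) ->
  g_sigma_preimage coord_rV (\bigcup_i (F i)).
Proof. exact: sigma_algebra_bigcup. Qed.

HB.instance Definition _ := @isMeasurable.Build measure_rV_display
  'rV[R]_n (g_sigma_preimage coord_rV) rV_set0 rV_setC rV_bigcup.

Lemma measurable_coord_rV (i : 'I_n) : measurable_fun [set: 'rV[R]_n] (coord_rV i).
Proof.
move=> _ Y mY; rewrite setTI; apply: sub_sigma_algebra => /=.
rewrite -bigcup_seq/=; exists i => /=; first by rewrite mem_index_enum.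
by exists Y => //; rewrite setTI.
Qed.

Lemma measurable_fun_rVP d (T : measurableType d) (f : T -> 'rV[R]_n) :
  (forall i, measurable_fun [set: T] (coord_rV i \o f)) ->
  measurable_fun [set: T] f.
Proof.
move=> mf _ A mA; rewrite setTI.
suff: g_sigma_preimage coord_rV `<=` [set B | measurable (f @^-1` B)] by apply.
apply: smallest_sub.
  split => /=.
  - by rewrite preimage_set0.
  - by move=> B mB; rewrite setTD preimage_setC; exact: measurableC.
  - by move=> B mB; rewrite preimage_bigcup; exact: bigcupT_measurable.
rewrite -bigcup_seq; apply: bigcup_sub => i _ B [C mC <-] /=.
by have := mf i measurableT C mC; rewrite !setTI comp_preimage.
Qed.

End measurable_rV.

Section lebesgue_rV.
Context (R : realType).

Definition cons_rV n (z : measurableTypeR R * 'rV[R]_n) : 'rV[R]_n.+1 :=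
  \row_i oapp (z.2 ord0) z.1 (unlift ord0 i).

Definition uncons_rV n (v : 'rV[R]_n.+1) : measurableTypeR R * 'rV[R]_n :=
  (v ord0 ord0, \row_i v ord0 (lift ord0 i)).

Lemma cons_rV0 n z : @cons_rV n z ord0 ord0 = z.1.
Proof. by rewrite mxE unlift_none. Qed.

Lemma cons_rVS n z i : @cons_rV n z ord0 (lift ord0 i) = z.2 ord0 i.
Proof. by rewrite mxE liftK. Qed.

Lemma cons_rVK n : cancel (@cons_rV n) (@uncons_rV n).
Proof.
case=> x v; rewrite /uncons_rV cons_rV0; congr pair.
by apply/rowP => i; rewrite mxE cons_rVS.
Qed.

Lemma uncons_rVK n : cancel (@uncons_rV n) (@cons_rV n).
Proof.
move=> v; apply/rowP => i; case: (unliftP ord0 i) => [j ->|->].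
  by rewrite cons_rVS mxE.
by rewrite cons_rV0.
Qed.

Lemma measurable_cons_rV n : measurable_fun setT (@cons_rV n).
Proof.
apply: measurable_fun_rVP => i; case: (unliftP ord0 i) => [j ->|->].
  rewrite (_ : _ \o _ = coord_rV j \o snd).
    apply: measurableT_comp => //; exact: measurable_coord_rV.
  by apply/funext => z /=; rewrite /coord_rV cons_rVS.
rewrite (_ : _ \o _ = fst) //.
by apply/funext => z /=; rewrite /coord_rV cons_rV0.
Qed.

Lemma measurable_uncons_rV n : measurable_fun setT (@uncons_rV n).
Proof.
apply/measurable_fun_pairP; split => /=; first exact: measurable_coord_rV.
apply: measurable_fun_rVP => i.
rewrite (_ : _ \o _ = coord_rV (lift ord0 i)); first exact: measurable_coord_rV.
by apply/funext => v /=; rewrite /coord_rV mxE.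
Qed.

Section step.
Context (n : nat) (mu : {sigma_finite_measure set 'rV[R]_n -> \bar R}).

Definition lebesgue_rV_step : set 'rV[R]_n.+1 -> \bar R :=
  pushforward (@lebesgue_measure R \x mu) (@cons_rV n).

Let step0 : lebesgue_rV_step set0 = 0.
Proof. by rewrite /lebesgue_rV_step /pushforward preimage_set0 measure0. Qed.

Let measurable_preimage_cons A :
  measurable A -> measurable (@cons_rV n @^-1` A).
Proof.
by move=> mA; rewrite -[X in measurable X]setTI; exact: measurable_cons_rV.
Qed.

Let step_ge0 A : 0 <= lebesgue_rV_step A.
Proof. by rewrite /lebesgue_rV_step /pushforward measure_ge0. Qed.

Let step_sigma_additive : semi_sigma_additive lebesgue_rV_step.
Proof.
move=> F mF tF mUF; rewrite /lebesgue_rV_step /pushforward preimage_bigcup.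
apply: measure_semi_sigma_additive.
- by move=> i; exact: measurable_preimage_cons.
- apply/trivIsetP => /= i j _ _ ij; rewrite -preimage_setI.
  by move/trivIsetP : tF => /(_ _ _ _ _ ij) ->//; rewrite preimage_set0.
- by rewrite -preimage_bigcup; exact: measurable_preimage_cons.
Qed.

HB.instance Definition _ := isMeasure.Build _ _ _ lebesgue_rV_step
  step0 step_ge0 step_sigma_additive.

Let step_sigma_finite : sigma_finite setT lebesgue_rV_step.
Proof.
have /sigma_finiteP[F [TF ndF Foo]] := sigma_finiteT (@lebesgue_measure R).
have /sigma_finiteP[G [TG ndG Goo]] := sigma_finiteT mu.
exists (fun k => @uncons_rV n @^-1` (F k `*` G k)).
  rewrite -preimage_bigcup -(preimage_setT (@uncons_rV n)); congr (_ @^-1` _).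
  rewrite -setXTT TF TG predeqE => -[x y]; split.
    move=> [/= [i _ Fix] [j _ Gjy]]; exists (maxn i j) => //; split.
    - by move: x Fix; exact/subsetPset/ndF/leq_maxl.
    - by move: y Gjy; exact/subsetPset/ndG/leq_maxr.
  by move=> [i _ []/= ? ?]; split; exists i.
move=> k; have [mF Fk] := Foo k; have [mG Gk] := Goo k; split.
  rewrite -[X in measurable X]setTI; apply: measurable_uncons_rV => //.
  exact: measurableX.
rewrite /lebesgue_rV_step /pushforward.
rewrite (_ : _ @^-1` _ = F k `*` G k); last first.
  by apply/funext => z; exact: (congr1 (F k `*` G k) (cons_rVK z)).
by rewrite product_measure1E// lte_mul_pinfty// ge0_fin_numE.
Qed.

HB.instance Definition _ := @Measure_isSigmaFinite.Build _ _ _ lebesgue_rV_step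
  step_sigma_finite.

End step.

Fixpoint lebesgue_rV (n : nat) : {sigma_finite_measure set 'rV[R]_n -> \bar R} :=
  if n is m.+1 then lebesgue_rV_step (lebesgue_rV m)
  else \d_(0%R : 'rV[R]_0).

Lemma measurable_box_rV n (A : 'I_n -> set (measurableTypeR R)) :
  (forall i, measurable (A i)) ->
  measurable [set v : 'rV[R]_n | forall i, A i (v ord0 i)].
Proof.
move=> mA; rewrite (_ : mkset _ = \bigcap_(i in setT) (coord_rV i @^-1` A i)).
  apply: fin_bigcap_measurable => // i _; rewrite -[X in measurable X]setTI.
  exact: (@measurable_coord_rV R n i measurableT (A i) (mA i)).
by apply/seteqP; split => v /= Av i; [move=> _|]; exact: Av.
Qed.

(* Volume of a box; the boxes generate the sigma-algebra, so this determines
   [lebesgue_rV n]. *)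
Lemma lebesgue_rV_box n (A : 'I_n -> set (measurableTypeR R)) :
  (forall i, measurable (A i)) ->
  lebesgue_rV n [set v | forall i, A i (v ord0 i)] =
  \prod_(i < n) lebesgue_measure (A i).
Proof.
elim: n A => [|n IHn] A mA.
  by rewrite big_ord0 /= diracE mem_set// => -[].
rewrite big_ord_recl -IHn// -product_measure1E//; last first.
  exact: (@measurable_box_rV n (fun i => A (lift ord0 i))).
rewrite /= /lebesgue_rV_step /pushforward; congr (product_measure1 _ _ _).
apply/seteqP; split => -[x v] /=.
  move=> Av; split; first by have := Av ord0; rewrite cons_rV0.
  by move=> i; have := Av (lift ord0 i); rewrite cons_rVS.
move=> [Ax Av] i; case: (unliftP ord0 i) => [j ->|->].
  by rewrite cons_rVS.
by rewrite cons_rV0.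
Qed.

End lebesgue_rV.

(* The library's integral is total: it evaluates to [-oo] when the positive and
   the negative part both have infinite integral.  [integral_defined mu f]
   excludes this case; infinite values remain allowed. *)
Definition integral_defined d (T : measurableType d) (R : realType)
    (mu : {measure set T -> \bar R}) (f : T -> \bar R) : Prop :=
  (\int[mu]_x f^\+ x) +? (- \int[mu]_x f^\- x).

Section kernel_law.
Context d d' (X : measurableType d) (Y : measurableType d') (R : realType).

(* [k x] is only a bundled measure; this is the same measure as a [probability]. *)
Definition kernel_law (k : R.-pker X ~> Y) (x : X) : set Y -> \bar R := k x.

HB.instance Definition _ k x := Measure.on (kernel_law k x).

HB.instance Definition _ k x :=
  Measure_isProbability.Build _ _ _ (kernel_law k x) (prob_kernel (s := k) x).

End kernel_law.

Section entropy.
Context (R : realType) (n : nat).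
Implicit Types beta : probability 'rV[R]_n R.

Definition density beta (y : 'rV[R]_n) : R :=
  fine (('d (charge_of_finite_measure beta) '/d (lebesgue_rV R n)) y).

(* Differential entropy.  [ln 0 = 0] in the library, hence the usual convention
   [0 log 0 = 0].  The entropy of a distribution without density, or whose
   entropy integral has the form [oo - oo], is [-oo]. *)
Definition entropy beta : \bar R :=
  let g y := (density beta y * ln (density beta y))%:E in
  if `[< beta `<< lebesgue_rV R n /\ integral_defined (lebesgue_rV R n) g >]
  then - (\int[lebesgue_rV R n]_y g y) else -oo.

End entropy.

Section eot.
Context (R : realType) (Dx Dy : nat).
Local Notation X := 'rV[R]_Dx.
Local Notation Y := 'rV[R]_Dy.
Implicit Types (alpha : probability X R) (beta : probability Y R).
Implicit Types (pi : probability (X * Y)%type R) (k : R.-pker X ~> Y).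
Implicit Types (eps : R) (c : X * Y -> R) (f : Y -> R).

Definition couplings alpha beta : set (probability (X * Y)%type R) :=
  [set pi | (forall A, measurable A -> pi (A `*` setT) = alpha A) /\
            (forall B, measurable B -> pi (setT `*` B) = beta B)].

(* [k x] is a version of pi( . | x). *)
Definition conditional alpha pi k : Prop :=
  forall A B, measurable A -> measurable B ->
    pi (A `*` B) = \int[alpha]_(x in A) k x B.

Definition expected_entropy alpha k : \bar R := \int[alpha]_x entropy (kernel_law k x).

Definition eot_objective eps c alpha pi k : \bar R :=
  (\int[pi]_z (c z)%:E) - eps%:E * expected_entropy alpha k.

Definition eot_objective_defined eps c alpha pi k : Prop :=
  [/\ integral_defined pi (EFin \o c),
      integral_defined alpha (fun x => entropy (kernel_law k x)) &
      (\int[pi]_z (c z)%:E) +? (- (eps%:E * expected_entropy alpha k))].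

(* Every coupling on R^Dx x R^Dy has a conditional distribution, unique up to
   alpha-null sets, and the objective does not depend on its choice: the
   infimum ranges over all couplings whose objective makes sense. *)
Definition EOT eps c alpha beta : \bar R :=
  ereal_inf [set v | exists pi k,
    [/\ couplings alpha beta pi, conditional alpha pi k,
        eot_objective_defined eps c alpha pi k &
        v = eot_objective eps c alpha pi k]].

(* The weak entropic c-transform; it takes the value [-oo] where the integral
   diverges. *)
Definition ctransform eps c f (x : X) : \bar R :=
  - (eps%:E *
     lne (\int[lebesgue_rV R Dy]_y (expR ((f y - c (x, y)) / eps))%:E)).

Definition semidual eps c alpha beta f : \bar R :=
  (\int[alpha]_x ctransform eps c f x) + (\int[beta]_y (f y)%:E).

Definition is_max (S : set (\bar R)) (v : \bar R) : Prop := S v /\ ubound S v.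

Definition energy eps c f (x : X) (y : Y) : R := (c (x, y) - f y) / eps.

Definition normalization eps c f (x : X) : \bar R :=
  \int[lebesgue_rV R Dy]_y (expR (- energy eps c f x y))%:E.

Definition loss eps c f alpha beta pi : \bar R :=
  eps^-1%:E * (\int[pi]_z (c z)%:E) - eps^-1%:E * (\int[beta]_y (f y)%:E) +
  (\int[alpha]_x lne (normalization eps c f x)).

End eot.

(* Main.v *)
Require Import Defs.
From mathcomp Require Import all_boot all_order all_algebra.
From mathcomp Require Import all_classical all_reals all_analysis.
From mathcomp Require Import ring.
Import Order.TTheory GRing.Theory Num.Theory.
Import numFieldNormedType.Exports.
Local Open Scope classical_set_scope.
Local Open Scope ring_scope.
Local Open Scope ereal_scope.

(* For a fixed cost [c], subtracting the semi-dual maximum is the same as taking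
   the infimum over potentials [f] of the difference, so the two infima merge
   into one over pairs [(c, f)].  Everything else is bookkeeping with finite
   expectations: the entropy term does not depend on [c], and
   [f^c = - eps log Z] pointwise. *)

(** A finite [x] can be moved across an inequality, so translation by it is an order automorphism of
    [\bar R]; this also covers an empty [S] and an infimum equal to [-oo]. *)
Lemma ereal_infDl {R : realType} {x : \bar R} (S : set (\bar R)) :
  x \is a fin_num -> ereal_inf [set x + y | y in S] = x + ereal_inf S.
Proof.
move=> xfin; apply/eqP; rewrite eq_le; apply/andP; split; last first.
  by apply: le_ereal_inf_tmp => _ [y Sy <-]; rewrite leeD2l// ereal_inf_lbound.
rewrite -leeBlDl//; apply: le_ereal_inf_tmp => y Sy.
by rewrite leeBlDl//; apply: ereal_inf_lbound; exists y.
Qed.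

(** The two halves of [is_max] give the two inequalities: the bound [s t u <= m t] yields
    [a t - m t <= a t - s t u], and attainment makes [a t - m t] one of the values on the right. *)
Lemma ereal_inf_sub_max {R : realType} {T U : Type} {A : set T} {B : set U}
    (a m : T -> \bar R) (s : T -> U -> \bar R) :
  (forall t, A t -> is_max [set s t u | u in B] (m t)) ->
  ereal_inf [set a t - m t | t in A] =
  ereal_inf [set a t - s t u | t in A & u in B].
Proof.
move=> mP; apply/eqP; rewrite eq_le; apply/andP; split.
  apply: le_ereal_inf_tmp => _ [t At [u Bu <-]].
  apply: ge_ereal_inf; exists (a t - m t); first by exists t.
  by apply: leeB => //; apply: (mP t At).2; exists u.
apply: le_ereal_inf_tmp => _ [t At <-].
have [[u Bu <-] _] := mP t At.
by apply: ereal_inf_lbound; exists t => //; exists u.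
Qed.

Lemma ctransform_normalization {R : realType} {Dx Dy : nat} (eps : R)
    (c : 'rV[R]_Dx * 'rV[R]_Dy -> R) (f : 'rV[R]_Dy -> R) x :
  ctransform eps c f x = - (eps%:E * lne (normalization eps c f x)).
Proof.
rewrite /ctransform /normalization; congr (- (_ * lne _)).
by apply: eq_integral => y _; rewrite /energy -mulNr opprB.
Qed.

(** Turns the log-partition term of [loss] into the transform term of the dual objective;
    integrability of the transform lets the scalar leave the integral. *)
Lemma integral_ctransform {R : realType} {Dx Dy : nat} {eps : R}
    {alpha : probability 'rV[R]_Dx R}
    {c : 'rV[R]_Dx * 'rV[R]_Dy -> R} {f : 'rV[R]_Dy -> R} : eps != 0%R ->
  alpha.-integrable setT (ctransform eps c f) ->
  \int[alpha]_x lne (normalization eps c f x) =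
  (- eps^-1)%:E * \int[alpha]_x ctransform eps c f x.
Proof.
move=> eps0 intf; rewrite -integralZl//; apply: eq_integral => x _.
(* The factor [eps] cancels pointwise, also where [lne] is infinite. *)
by rewrite ctransform_normalization EFinN muleNN muleA -EFinM mulVf// mul1e.
Qed.

Theorem mainTheorem2 (R : realType) (Dx Dy : nat)
  (pistar : probability ('rV[R]_Dx * 'rV[R]_Dy)%type R)
  (pix : probability 'rV[R]_Dx R) (piy : probability 'rV[R]_Dy R)
  (kstar : R.-pker 'rV[R]_Dx ~> 'rV[R]_Dy)
  (eps : R)
  (C : set ('rV[R]_Dx * 'rV[R]_Dy -> R)) (F : set ('rV[R]_Dy -> R)) :
  (0 < eps)%R ->
  (* pistar is absolutely continuous with marginals pix, piy and conditional
     distributions kstar x *)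
  pistar `<< (lebesgue_rV R Dx \x lebesgue_rV R Dy) ->
  couplings pix piy pistar ->
  conditional pix pistar kstar ->
  (forall c, C c -> measurable_fun setT c) ->
  (forall f, F f -> continuous f) ->
  (* finiteness of the expectations *)
  pix.-integrable setT (fun x => entropy (kernel_law kstar x)) ->
  (forall c, C c -> pistar.-integrable setT (EFin \o c)) ->
  (forall f, F f -> piy.-integrable setT (EFin \o f)) ->
  (forall c f, C c -> F f -> pix.-integrable setT (ctransform eps c f)) ->
  (* semi-dual representation *)
  (forall c, C c ->
    is_max [set semidual eps c pix piy f | f in F] (EOT eps c pix piy)) ->
  ereal_inf
    [set (\int[pistar]_z (c z)%:E) - eps%:E * expected_entropy pix kstar
         - EOT eps c pix piy | c in C]
  = - (eps%:E * expected_entropy pix kstar) +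
    ereal_inf
      [set (\int[pistar]_z (c z)%:E) - (\int[pix]_x ctransform eps c f x)
           - (\int[piy]_y (f y)%:E) | c in C & f in F]
  /\
  (forall (Theta : Type)
     (cth : Theta -> 'rV[R]_Dx * 'rV[R]_Dy -> R)
     (fth : Theta -> 'rV[R]_Dy -> R) (theta : Theta),
     C (cth theta) -> F (fth theta) ->
     (forall x, ctransform eps (cth theta) (fth theta) x =
        - (eps%:E * lne (normalization eps (cth theta) (fth theta) x))) /\
     (\int[pistar]_z (cth theta z)%:E)
       - (\int[pix]_x ctransform eps (cth theta) (fth theta) x)
       - (\int[piy]_y (fth theta y)%:E)
     = eps%:E * loss eps (cth theta) (fth theta) pix piy pistar).
Proof.
move=> eps0 _ _ _ _ _ intH intC intF intcf maxF.
have aE c : C c -> \int[pistar]_z (c z)%:E \is a fin_num.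
  by move=> Cc; exact: integrable_fin_num (intC c Cc).
have fE f : F f -> \int[piy]_y (f y)%:E \is a fin_num.
  by move=> Ff; exact: integrable_fin_num (intF f Ff).
have cfE c f : C c -> F f -> \int[pix]_x ctransform eps c f x \is a fin_num.
  by move=> Cc Ff; exact: integrable_fin_num (intcf c f Cc Ff).
have HE : - (eps%:E * expected_entropy pix kstar) \is a fin_num.
  by rewrite fin_numN fin_numM//; exact: integrable_fin_num intH.
have sdE c f : F f -> \int[pistar]_z (c z)%:E - semidual eps c pix piy f =
    (\int[pistar]_z (c z)%:E) - (\int[pix]_x ctransform eps c f x)
      - (\int[piy]_y (f y)%:E).
  move=> /fE Ff; rewrite /semidual.
  (* Finiteness of the expectation of [f] lets the minus sign distribute over the extended sum. *)
  by rewrite [X in _ + X](fin_num_oppeD _ Ff) addeA.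
split=> [|Theta cth fth theta Cc Ff].
  rewrite -ereal_infDl//.
  (* The entropy term is moved to the front of each value, so that, being finite and independent of
     [c], it can leave the infimum. *)
  transitivity (ereal_inf [set - (eps%:E * expected_entropy pix kstar) + v |
      v in [set (\int[pistar]_z (c z)%:E) - EOT eps c pix piy | c in C]]).
    rewrite image_comp; congr ereal_inf; apply: eq_imagel => c Cc /=.
    by rewrite addeAC addeC.
  rewrite !ereal_infDl//; congr (_ + _).
  (* The semi-dual representation enters here, with [EOT] as the maximum and [semidual] as the
     maximised family. *)
  rewrite (ereal_inf_sub_max _ _ _ maxF); congr ereal_inf.
  apply/seteqP; split => _ [c Cc [f Ff <-]]; exists c => //; exists f => //;
    by rewrite sdE.
split=> [x|]; first exact: ctransform_normalization.
rewrite /loss integral_ctransform ?gt_eqF//; last exact: intcf.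
(* All three expectations are finite, so the claim becomes a field identity in [R], with [eps]
   nonzero. *)
rewrite -(fineK (aE _ Cc)) -(fineK (fE _ Ff)) -(fineK (cfE _ _ Cc Ff)).
rewrite -!EFinM -!EFinB; congr EFin.
by field; rewrite gt_eqF.
Qed.
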